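(* For all real numbers $[f],[g],[w]\in\mathcal{S}_{\mathbb{R}}$ we have $([f]+[g])+[w]=[f]+([g]+[w])$.
   Context: Conventions. $\omega=\{0,1,2,\dots\}$, $\omega_+=\omega\setminus\{0\}$, $[a,b]_\omega=\{n\in\omega:a\le n\le b\}$, $[a,\infty]_\omega=\{n\in\omega:n\ge a\}$. A system function $\vartheta:\omega_+\to[2,\infty]_\omega$ is fixed. Contractions. For $f:\omega\to\omega$ and $n\in\omega_+$, the contraction $c_n$ is applicable to $f$ iff $f(n+1)\ge\vartheta(n)$, and then $c_n(f)(n)=f(n)+1$, $c_n(f)(n+1)=f(n+1)-\vartheta(n)$, $c_n(f)(k)=f(k)$ for other $k$. A sequence of contractions is a finite (possibly empty) composition of contractions; it is applicable to $f$ iff each contraction in turn is applicable to the result of the preceding ones. Sign. For $f:\omega\to\omega$, $\sigma(f)=0$ if $f(0)$ is odd and $\sigma(f)=1$ if $f(0)$ is even. Auxiliary functions. $h:\omega\to\omega$ is a primary auxiliary function ($h\in A_p$) if $h(k)<\vartheta(k-1)$ for all $k\ge2$ and for every $N\in\omega_+$ there is $M\ge N+1$ with $h(M)\ne\vartheta(M-1)-1$. It is a secondary auxiliary function ($h\in A_s$) if $h(k)<\vartheta(k-1)$ for all $k\ge2$ and there is $N\in\omega_+$ with $h(M)=\vartheta(M-1)-1$ for all $M\ge N+1$; the least such $N$ is $N^h_{\min}$. Base set. $W_1$ is the set of pairs $(h_p,h_s)\in A_p\times A_s$ such that, with $N=N^{h_s}_{\min}$, $h_p(k)=h_s(k)$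 for $k<N$, $h_p(N)=h_s(N)+1$, and $h_p(k)=0$ for $k>N$. Two pairs in $W_1$ are equivalent if their first components agree on $\omega_+$ and have the same sign; $F$ is the collection of sets obtained by taking, for each equivalence class, the set of all functions that are components of its pairs. $W_2$ is the set of primary auxiliary functions occurring in no pair of $W_1$; two elements of $W_2$ are equivalent if they agree on $\omega_+$ and have the same sign; $G_2$ is the set of equivalence classes. The base set is $B=F\cup G_2$. Real numbers. For $b\in B$, $r_b$ is the set of $f:\omega\to\omega$ for which there is $h\in b$ such that for every $N\in\omega_+$ some sequence of contractions $\mathcal{C}$ applicable to $f$ satisfies $\mathcal{C}(f)(n)=h(n)$ for all $n\in[0,N]_\omega$. Let $b_1,b_2\in B$ be the elements containing respectively the zero function, and the function with value $1$ at $0$ and $0$ elsewhere. $\mathcal{S}_{\mathbb{R}}$ (the set of real numbers) consists of all $r_b$ with $b\in B\setminus\{b_1,b_2\}$ together with $[0]:=r_{b_1}\cup r_{b_2}$. Put $\mathcal{S}_{\mathbb{R}}^*=\mathcal{S}_{\mathbb{R}}\setminus\{[0]\}$. Distinct real numbers are disjoint. A function lying in some real number is called finite, and $[f]$ denotes the real number containing $f$. For $[a]\in\mathcal{S}_{\mathbb{R}}^*$ all elements have the same sign, denoted $\sigma([a])$. Every real number $[x]$ contains primary auxiliary functions, and they all agree on $\omega_+$; $x_p$ denotes one of them. Order. For $[a],[b]\in\mathcal{S}_{\mathbb{R}}^*$, $[a]\le[b]$ iff one of the following holds: (i) $\sigma([a])<\sigma([b])$; (ii) $\sigma([a])=\sigma([b])=1$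 and for every $a\in[a]$ there is $b\in[b]$ with $a(n)\le b(n)$ for all $n\in\omega_+$; (iii) $\sigma([a])=\sigma([b])=0$ and for every $b\in[b]$ there is $a\in[a]$ with $a(n)\ge b(n)$ for all $n\in\omega_+$. For $[a]\in\mathcal{S}_{\mathbb{R}}^*$, $[a]\le[0]$ iff $\sigma([a])=0$, and $[0]\le[a]$ iff $\sigma([a])=1$. Finally $[0]\le[0]$ holds. Strict order: $[a]<[b]$ iff not $[b]\le[a]$. Addition. The absolute value $|f|$ of $f:\omega\to\omega$ is the function with $|f|(0)=0$ and $|f|(k)=f(k)$ for $k\in\omega_+$; for a real number, $|[x]|:=[|f|]$ for any $f\in[x]$ (independent of $f$). For finite $f,g$ with $|[f]|>|[g]|$, the set of tracking functions $\mathcal{T}^f_g$ consists of all $\varrho:\omega\to\omega$ for which there is $w\in[f]$ with $w(n)\ge g(n)$ for all $n\in\omega_+$, $\varrho(0)=w(0)$ and $\varrho(n)=w(n)-g(n)$ for all $n\in\omega_+$. If moreover $\sigma(f)\ne\sigma(g)$ or $g\in[0]$, then $\mathcal{T}^f_g$ is non-empty and contained in a single real number $[x]$, and the primary tracking function $\varrho^f_g$ is defined by $\varrho^f_g(0)=f(0)$, $\varrho^f_g(k)=x_p(k)$ for $k\in\omega_+$. For finite $f,g$ the sub-sum $f+g:\omega\to\omega$ is: if $\sigma(f)=\sigma(g)$ and $f,g\notin[0]$, then $(f+g)(0)=f(0)g(0)$ and $(f+g)(k)=f(k)+g(k)$ for $k\in\omega_+$; otherwise $f+g$ is the zero function if $|[f]|=|[g]|$,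 is $\varrho^f_g$ if $|[f]|>|[g]|$, and is $\varrho^g_f$ if $|[f]|<|[g]|$. Addition of real numbers: $[f]+[g]:=[f+g]$ for any $f\in[f]$, $g\in[g]$ (independent of the choice of representatives). *)

(* Defs.v *)
From mathcomp Require Import all_boot.
From mathcomp Require Import boolp classical_sets.
Set Implicit Arguments.
Unset Strict Implicit.
Unset Printing Implicit Defensive.

Local Open Scope classical_set_scope.

Section Contractions.

(* The system function is a total [nat -> nat] whose value at 0 is never used;
   the bound [2 <= theta n] for [0 < n] is a hypothesis of the theorem. *)
Variable theta : nat -> nat.
Implicit Types (n k N M : nat) (f g h w : nat -> nat).

Definition contract n f : nat -> nat := fun k =>
  if k == n then (f n).+1 else if k == n.+1 then f n.+1 - theta n else f k.

Definition applicable n f : bool := (0 < n) && (theta n <= f n.+1).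

(* [:: n1; n2; ...] stands for "first c_n1, then c_n2, ..." *)
Fixpoint contracts (s : seq nat) f : nat -> nat :=
  if s is n :: s' then contracts s' (contract n f) else f.

Fixpoint applicables (s : seq nat) f : bool :=
  if s is n :: s' then applicable n f && applicables s' (contract n f)
  else true.

Definition sigma f : nat := if odd (f 0) then 0 else 1.

Definition A_p : set (nat -> nat) := [set h |
  (forall k, 2 <= k -> h k < theta k.-1) /\
  (forall N, 0 < N -> exists2 M, N.+1 <= M & h M <> (theta M.-1).-1)].

Definition maximal_after h N : Prop :=
  0 < N /\ forall M, N.+1 <= M -> h M = (theta M.-1).-1.

Definition A_s : set (nat -> nat) := [set h |
  (forall k, 2 <= k -> h k < theta k.-1) /\ exists N, maximal_after h N].

Definition is_Nmin h N : Prop :=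
  maximal_after h N /\ forall N', maximal_after h N' -> N <= N'.

Definition W1 : set ((nat -> nat) * (nat -> nat)) := [set p |
  [/\ A_p p.1, A_s p.2 &
   exists N, [/\ is_Nmin p.2 N,
                 forall k, k < N -> p.1 k = p.2 k,
                 p.1 N = (p.2 N).+1 &
                 forall k, N < k -> p.1 k = 0]]].

Definition similar h h' : Prop :=
  (forall k, 0 < k -> h k = h' k) /\ sigma h = sigma h'.

Definition component h (p : (nat -> nat) * (nat -> nat)) : Prop :=
  h = p.1 \/ h = p.2.

Definition F : set (set (nat -> nat)) :=
  [set [set h | exists q, [/\ W1 q, similar p.1 q.1 & component h q]]
  | p in W1].

Definition W2 : set (nat -> nat) :=
  [set h | A_p h /\ ~ exists2 p, W1 p & component h p].

Definition G2 : set (set (nat -> nat)) :=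
  [set [set h' | W2 h' /\ similar h h'] | h in W2].

Definition B : set (set (nat -> nat)) := F `|` G2.

Definition r (b : set (nat -> nat)) : set (nat -> nat) := [set f |
  exists2 h, b h & forall N, 0 < N ->
    exists2 s, applicables s f & forall n, n <= N -> contracts s f n = h n].

(* The element of a family P of disjoint sets that contains f
   (the empty set if there is none). *)
Definition block (P : set (set (nat -> nat))) f : set (nat -> nat) :=
  xget set0 [set X | P X /\ X f].

Definition b1 : set (nat -> nat) := block B (fun=> 0).
Definition b2 : set (nat -> nat) := block B (fun k => if k == 0 then 1 else 0).

Definition zeroR : set (nat -> nat) := r b1 `|` r b2.

Definition S_R : set (set (nat -> nat)) :=
  r @` (B `\` [set b1; b2]) `|` [set zeroR].

(* [f], the real number containing the finite function f. *)
Definition class f : set (nat -> nat) := block S_R f.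

(* An arbitrary element of a real number; it serves to define the notions
   that do not depend on the choice of a representative. *)
Definition repr (X : set (nat -> nat)) : nat -> nat := xget (fun=> 0) X.

Definition sigmaR X : nat := sigma (repr X).

(* x_p for [x] = X. *)
Definition primary X : nat -> nat := xget (fun=> 0) (X `&` A_p).

(* Only meaningful for real numbers X and Y. *)
Definition leR X Y : Prop :=
  [\/ [/\ X <> zeroR, Y <> zeroR &
        [\/ sigmaR X < sigmaR Y,
            [/\ sigmaR X = 1, sigmaR Y = 1 &
              forall a, X a -> exists2 b, Y b & forall n, 0 < n -> a n <= b n] |
            [/\ sigmaR X = 0, sigmaR Y = 0 &
              forall b, Y b -> exists2 a, X a & forall n, 0 < n -> b n <= a n]]],
      [/\ X <> zeroR, Y = zeroR & sigmaR X = 0],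
      [/\ X = zeroR, Y <> zeroR & sigmaR Y = 1] |
      X = zeroR /\ Y = zeroR].

Definition ltR X Y : Prop := ~ leR Y X.

Definition absf f : nat -> nat := fun k => if k == 0 then 0 else f k.

Definition absR X : set (nat -> nat) := class (absf (repr X)).

Definition tracking f g : set (nat -> nat) := [set rho |
  exists w, [/\ class f w,
                forall n, 0 < n -> g n <= w n,
                rho 0 = w 0 &
                forall n, 0 < n -> rho n = w n - g n]].

(* The real number that includes all tracking functions; used only when
   [tracking f g] is nonempty, so that there is just one. *)
Definition tracking_class f g : set (nat -> nat) :=
  xget set0 [set X | S_R X /\ tracking f g `<=` X].

Definition primary_tracking f g : nat -> nat := fun k =>
  if k == 0 then f 0 else primary (tracking_class f g) k.

(* The order on real numbers is total, so the last branch is the case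
   |[f]| < |[g]|. *)
Definition subsum f g : nat -> nat :=
  if `[< [/\ sigma f = sigma g, ~ zeroR f & ~ zeroR g] >] then
    fun k => if k == 0 then f 0 * g 0 else f k + g k
  else if `[< absR (class f) = absR (class g) >] then fun=> 0
  else if `[< ltR (absR (class g)) (absR (class f)) >] then primary_tracking f g
  else primary_tracking g f.

Definition addR X Y : set (nat -> nat) := class (subsum (repr X) (repr Y)).

End Contractions.

(* Main.v *)
Require Import Defs.
From mathcomp Require Import all_boot order ssralg ssrnum archimedean.
From mathcomp Require Import boolp classical_sets reals Rstruct.
From mathcomp Require Import ring lra zify.

(* The position n >= 1 of a function f carries the weight
   1 / (theta 1 * ... * theta (n-1)), and contractions preserve the weighted
   sum of f. A contraction can only increase the prefix sums, and it changes
   just one of them; hence, if contractions of f converge to h, then f and h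
   have the same value, and a function of finite value can be reduced to a
   stable normal form. Two normal forms of the same value either agree or form
   a pair of W1 (the terminating and the maximal expansion of one number). So a
   real number is the set of all functions with a given sign and a given value,
   and addition is the addition of signed values, which is associative. *)

Set Implicit Arguments.
Unset Strict Implicit.
Unset Printing Implicit Defensive.
Import Order.TTheory GRing.Theory Num.Theory.

(** * Prefix sums and reduction to normal form *)

Section NumberSystem.
Variable theta : nat -> nat.
Hypothesis theta_ge2 : forall n, 0 < n -> 2 <= theta n.
Implicit Types (f g h : nat -> nat) (n m k N M : nat).

(* [numer f n / scale n] is the weighted sum of the positions 1, ..., n.+1. *)
Fixpoint scale n : nat := if n is m.+1 then scale m * theta m.+1 else 1.

Fixpoint numer f n : nat :=
  if n is m.+1 then numer f m * theta m.+1 + f m.+2 else f 1.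

Lemma scale_gt n : n < scale n.
Proof.
elim: n => //= n IHn.
have := theta_ge2 (ltn0Sn n); nia.
Qed.

Lemma scale_gt0 n : 0 < scale n.
Proof. exact: leq_ltn_trans (scale_gt n). Qed.

Definition posEq f g := forall k, 0 < k -> f k = g k.

Lemma eq_numer f g : posEq f g -> numer f =1 numer g.
Proof. by move=> fg; elim=> [|n IHn] /=; rewrite ?IHn fg. Qed.

Lemma numer_inj f g m :
  (forall k, k <= m -> numer f k = numer g k) ->
  forall k, 0 < k <= m.+1 -> f k = g k.
Proof.
move=> fg [|[|k]] //=; first by move=> _; have := fg 0 isT.
rewrite ltnS => km; have := fg k.+1 km => /=.
by rewrite (fg k (ltnW km)) => /addnI.
Qed.

Lemma numerD f g h n :
  (forall k, 0 < k -> h k = f k + g k) -> numer h n = numer f n + numer g n.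
Proof. by move=> hfg; elim: n => [|n IHn] /=; rewrite ?IHn hfg //; ring. Qed.

Lemma leq_numer f g n : (forall k, 0 < k <= n.+1 -> f k <= g k) ->
  numer f n <= numer g n.
Proof.
elim: n => [|n IHn] fg /=; first exact: fg.
apply: leq_add; last by rewrite fg /=.
rewrite leq_mul2r IHn ?orbT // => k /andP[k0 kn].
by rewrite fg // k0 leqW.
Qed.

(* Only the prefix that separates [m.+1] from [m.+2] sees the move. *)
Lemma numer_contract f m n : applicable theta m.+1 f ->
  numer (contract theta m.+1 f) n = numer f n + (n == m).
Proof.
rewrite /applicable /= => hf; elim: n => [|n IHn] /=.
  by rewrite /contract eqSS; case: m hf => [|m] //= _; rewrite ?addn0 ?addn1.
rewrite IHn /contract !eqSS.
have [->|nm] := eqVneq n m.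
  by rewrite (_ : m.+1 == m = false) //=; [nia | lia].
by have [->|nm'] := eqVneq n.+1 m => /=; rewrite ?addn0 ?addn1 ?addnS.
Qed.

(** Each contraction raises exactly one prefix sum, so finitely many of them leave all sufficiently
    long prefix sums unchanged. *)
Lemma contracts_numer s f : applicables theta s f ->
  [/\ contracts theta s f 0 = f 0,
      forall n, numer f n <= numer (contracts theta s f) n &
      exists n, forall m, n <= m ->
        numer (contracts theta s f) m = numer f m].
Proof.
elim: s f => [|[|n] s IHs] f //=; first by move=> _; split=> //; exists 0.
case/andP=> hf /IHs[-> le1 [N eqN]]; split=> // [m|].
  by apply: leq_trans (le1 m); rewrite numer_contract // leq_addr.
exists (maxn N n.+1) => m; rewrite geq_max => /andP[Nm nm].
by rewrite eqN // numer_contract // gtn_eqF // addn0.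
Qed.

(** Position 1 plays the part of the integer part, so it carries no bound. *)
Definition normal h := forall n, h n.+2 < theta n.+1.

Lemma normalP h : normal h <-> forall k, 2 <= k -> h k < theta k.-1.
Proof. by split=> [hh [|[|k]]|hh n] //; apply: hh. Qed.

(** Rounding a prefix up by one unit of its last place bounds every longer prefix: digits below
    their base never fill that unit. *)
Lemma numer_normal_lt h n d : normal h ->
  (numer h (n + d)).+1 * scale n <= (numer h n).+1 * scale (n + d).
Proof.
move=> hh; elim: d => [|d IHd]; first by rewrite addn0.
rewrite addnS /=; have := hh (n + d); nia.
Qed.

(** Monotonicity of the partial sums, with denominators cleared. *)
Lemma numer_mono f n d : numer f n * scale (n + d) <= numer f (n + d) * scale n.
Proof.
elim: d => [|d IHd]; first by rewrite addn0.
rewrite addnS /=; nia.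
Qed.

(* Every contraction at a position [n <= M] decreases the digit sum of the
   first [M.+1] digits, so the reduction terminates. *)
Lemma reduce_prefix f M : exists2 s, applicables theta s f &
  numer (contracts theta s f) M = numer f M /\
  forall n, n < M -> contracts theta s f n.+2 < theta n.+1.
Proof.
move: {2}(\sum_(k < M.+2) f k) (leqnn (\sum_(k < M.+2) f k)) => d.
elim: d f => [|d IHd] f hd.
  exists [::] => //; split=> // n nM /=.
  have nM2 : n.+2 < M.+2 by [].
  move: hd; rewrite (bigD1 (Ordinal nM2)) //= leqn0 addn_eq0.
  by case/andP=> /eqP-> _; apply: ltnW (theta_ge2 _).
case: (pselect (exists2 n, n < M & theta n.+1 <= f n.+2)) => [[n nM hn]|nex].
  have app : applicable theta n.+1 f by rewrite /applicable.
  have [|s s_app [sM snorm]] := IHd (contract theta n.+1 f).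
    have i1 : n.+1 < M.+2 by lia.
    have i2 : n.+2 < M.+2 by lia.
    (* The move adds 1 at [n.+1] and removes [theta n.+1 >= 2] at [n.+2]; [rest] collects the
       untouched digits. *)
    pose rest g := \sum_(k < M.+2 | (k != Ordinal i1) && (k != Ordinal i2)) g k.
    have sumE g : \sum_(k < M.+2) g k = g n.+1 + (g n.+2 + rest g).
      rewrite (bigD1 (Ordinal i1)) //= (bigD1 (Ordinal i2)) //.
      by apply/eqP => /(congr1 val) /=; lia.
    have restE : rest (contract theta n.+1 f) = rest f.
      apply: eq_bigr => i /andP[/eqP h1 /eqP h2]; rewrite /contract.
      case: eqP => [e|_]; first by case: h1; apply: val_inj.
      by case: eqP => // e; case: h2; apply: val_inj.
    move: hd; rewrite !sumE restE /contract eqxx.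
    rewrite (_ : n.+2 == n.+1 = false) ?eqxx; last by lia.
    by have := theta_ge2 (ltn0Sn n); lia.
  exists (n.+1 :: s) => /=; first by rewrite app.
  by split=> //; rewrite sM numer_contract // gtn_eqF // addn0.
exists [::] => //; split=> // n nM; rewrite ltnNge; apply/negP => hn.
by apply: nex; exists n.
Qed.

(** For [N <= M] this is the quotient of [scale M] by [scale N]. *)
Definition span N M := \prod_(N <= i < M) theta i.+1.

Lemma span_gt0 N M : 0 < span N M.
Proof. by apply: prodn_gt0 => i; apply: ltnW (theta_ge2 _). Qed.

Lemma spanS N M : N <= M -> span N M.+1 = span N M * theta M.+1.
Proof. by move=> NM; rewrite /span big_nat_recr. Qed.

Lemma scale_span N M : N <= M -> scale M = scale N * span N M.
Proof.
elim: M => [|M IHM] NM.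
  by move: NM; rewrite leqn0 => /eqP->; rewrite /span big_geq.
have [->|NM'] := eqVneq N M.+1; first by rewrite /span big_geq ?muln1.
have {}NM : N <= M by lia.
by rewrite /= IHM // spanS // mulnA.
Qed.

(** With bounded digits the numerator is a mixed radix expansion, so dividing by the place value of
    the tail cuts the tail off. *)
Lemma numer_prefix f N M : (forall n, n < M -> f n.+2 < theta n.+1) ->
  N <= M -> numer f M %/ span N M = numer f N.
Proof.
elim: M => [|M IHM] hf NM.
  by move: NM; rewrite leqn0 => /eqP->; rewrite /span big_geq ?divn1.
have [->|NM'] := eqVneq N M.+1; first by rewrite /span big_geq ?divn1.
have {}NM : N <= M by lia.
have th0 : 0 < theta M.+1 by apply: ltnW (theta_ge2 _).
rewrite /= spanS // [span N M * _]mulnC divnMA divnMDl // (divn_small (hf M _)) // addn0.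
by apply: IHM => // n nM; apply: hf; lia.
Qed.

Lemma bounded_mono_stable (a : nat -> nat) N K :
  (forall M, N <= M -> a M <= a M.+1) -> (forall M, N <= M -> a M <= K) ->
  exists N', forall M, N' <= M -> a M = a N'.
Proof.
move=> mono bnd.
have mono2 M d : N <= M -> a M <= a (M + d).
  move=> NM; elim: d => [|d IHd]; first by rewrite addn0.
  by apply: leq_trans IHd _; rewrite addnS mono // (leq_trans NM) ?leq_addr.
have ex : exists v, `[< exists2 M, N <= M & a M = v >].
  by exists (a N); apply/asboolP; exists N.
have le v : `[< exists2 M, N <= M & a M = v >] -> v <= K.
  by move=> /asboolP[M NM <-]; apply: bnd.
case: (ex_maxnP ex le) => v /asboolP[M NM <-] vmax.
exists M => M' MM'; apply/eqP; rewrite eqn_leq; apply/andP; split.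
  by apply: vmax; apply/asboolP; exists M' => //; apply: leq_trans MM'.
by rewrite -(subnKC MM') mono2.
Qed.

(** The convergence by which [r] is defined. *)
Definition reduces f h := forall N, 0 < N ->
  exists2 s, applicables theta s f &
    forall n, n <= N -> contracts theta s f n = h n.

(** By [numer_prefix], reducing the first [M.+1] positions of [f] forces the prefix sum at [N] to be
    the quotient [T N M]. For fixed [N] these quotients grow with [M] and are bounded, so they
    stabilise, and the stable values are the prefix sums of the limit. *)
Lemma reduces_ex f K : (forall M, numer f M <= K * scale M) ->
  exists2 h, normal h & reduces f h.
Proof.
move=> bnd.
pose T N M := numer f M %/ span N M.
have ex N : exists N', forall M, N' <= M -> T N M = T N N'.
  apply: (@bounded_mono_stable (T N) N (K * scale N)) => M NM; rewrite /T.
    have th0 : 0 < theta M.+1 by apply: ltnW (theta_ge2 _).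
    rewrite spanS // [span N M * _]mulnC divnMA leq_div2r //=.
    by rewrite divnMDl // leq_addr.
  rewrite -(mulnK (K * scale N) (span_gt0 N M)) leq_div2r //.
  by rewrite -mulnA -scale_span.
have /choice[Mf MfP] := ex.
pose t N := T N (Mf N).
have tS N : t N = t N.+1 %/ theta N.+1.
  pose M := Mf N + Mf N.+1 + N.+1.
  rewrite /t -(MfP N M) -?(MfP N.+1 M) /M; try lia.
  rewrite /T -divnMA /span big_ltn; last by lia.
  by rewrite mulnC.
(* Digits are remainders, so that by [tS] the prefix sums of [h] are exactly the [t N]. *)
pose h k := if k is k1.+1 then
  if k1 is k2.+1 then t k1 %% theta k1 else t 0 else f 0.
have hN N : numer h N = t N.
  by elim: N => //= N ->; rewrite [in LHS]tS -divn_eq.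
exists h => [n|N N0]; first by rewrite ltn_pmod // ltnW ?theta_ge2.
(* [M] lies beyond the stabilisation index of every prefix up to [N]; adding [N] ensures [k <= M]
   for these prefixes. *)
pose M := \max_(k < N.+1) Mf k + N.
have [s s_app [sM snorm]] := reduce_prefix f M.
exists s => // n nN.
case: n nN => [|n] nN; first by case: (contracts_numer s_app).
apply: (@numer_inj _ _ N) => [k kN|]; last by lia.
have kM : k <= M by rewrite (leq_trans kN) // leq_addl.
rewrite -(numer_prefix snorm kM) sM hN -/(T k M) (MfP k) //.
have kN1 : k < N.+1 by [].
exact: leq_trans (leq_bigmax (Ordinal kN1)) (leq_addr _ _).
Qed.

(** * Values *)

Variable R : realType.
Local Open Scope ring_scope.
Implicit Types (x y z : R).

Definition partial f n : R := (numer f n)%:R / (scale n)%:R.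

(* A function with unbounded partial sums has no value. *)
Definition value f x :=
  (forall n, partial f n <= x) /\ (forall y, y < x -> exists n, y < partial f n).

Lemma scaleR_gt0 n : 0 < (scale n)%:R :> R.
Proof. by rewrite ltr0n scale_gt0. Qed.

Lemma partial_ge0 f n : 0 <= partial f n.
Proof. by rewrite divr_ge0 ?ler0n. Qed.

Lemma partial_le f n m : (n <= m)%N -> partial f n <= partial f m.
Proof.
move=> /subnKC <-; rewrite /partial ler_pdivrMr ?scaleR_gt0 // mulrAC.
by rewrite ler_pdivlMr ?scaleR_gt0 // -!natrM ler_nat numer_mono.
Qed.

Lemma value_ge0 f x : value f x -> 0 <= x.
Proof. by case=> /(_ 0%N) h _; apply: le_trans h; apply: partial_ge0. Qed.

Lemma value_uniq f x y : value f x -> value f y -> x = y.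
Proof.
move=> [ubx lx] [uby ly]; apply/eqP; rewrite eq_le !leNgt.
apply/andP; split; apply/negP.
  by move=> /lx[n]; rewrite ltNge uby.
by move=> /ly[n]; rewrite ltNge ubx.
Qed.

Lemma value_cofinal f g x :
  (forall n, exists m, partial f n <= partial g m) ->
  (forall n, exists m, partial g n <= partial f m) -> value f x -> value g x.
Proof.
move=> fg gf [ub lb]; split=> [n|y /lb[n yn]].
  by have [m /le_trans->] := gf n.
by have [m nm] := fg n; exists m; apply: lt_le_trans nm.
Qed.

Lemma eq_value f g x : posEq f g -> value f x -> value g x.
Proof.
by move=> /eq_numer fg; apply: value_cofinal => n; exists n; rewrite /partial fg.
Qed.

Lemma value_le f g x y : (forall k, (0 < k)%N -> (f k <= g k)%N) ->
  value f x -> value g y -> x <= y.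
Proof.
move=> fg [_ lb] [ub _]; rewrite leNgt; apply/negP => /lb[n].
rewrite ltNge => /negP; apply; apply: le_trans (ub n).
rewrite ler_pM2r ?invr_gt0 ?scaleR_gt0 // ler_nat.
by apply: leq_numer => k /andP[/fg].
Qed.

Lemma partialD f g h n : (forall k, (0 < k)%N -> h k = f k + g k)%N ->
  partial h n = partial f n + partial g n.
Proof. by move=> /numerD-/(_ n) hn; rewrite /partial hn natrD mulrDl. Qed.

Lemma valueD f g h x y : (forall k, (0 < k)%N -> h k = f k + g k)%N ->
  value f x -> value g y -> value h (x + y).
Proof.
move=> hfg [ubf lbf] [ubg lbg]; split=> [n|z zxy].
  by rewrite (partialD n hfg) lerD.
have [n hn] : exists n, x - (x + y - z) / 2 < partial f n by apply: lbf; lra.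
have [m hm] : exists n, y - (x + y - z) / 2 < partial g n by apply: lbg; lra.
exists (maxn n m); rewrite (partialD _ hfg).
have := partial_le f (leq_maxl n m); have := partial_le g (leq_maxr n m); lra.
Qed.

Lemma valueB f g h x y : (forall k, (0 < k)%N -> f k = h k + g k)%N ->
  value f x -> value g y -> value h (x - y).
Proof.
move=> hfg [ubf lbf] [ubg lbg]; split=> [n|z zxy].
  (* If [partial h n] exceeded [x - y], a partial sum of [g] close to [y] would push one of [f]
     above [x]. *)
  rewrite leNgt; apply/negP => hn.
  have [m hm] : exists m, x - partial h n < partial g m by apply: lbg; lra.
  have := ubf (maxn n m); rewrite (partialD _ hfg).
  have := partial_le h (leq_maxl n m); have := partial_le g (leq_maxr n m); lra.
have [n hn] : exists n, z + y < partial f n by apply: lbf; lra.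
by exists n; move: hn; rewrite (partialD _ hfg); have := ubg n; lra.
Qed.

Lemma value_reduces f h x : reduces f h -> value f x <-> value h x.
Proof.
move=> fh.
have fh1 n : partial f n <= partial h n.
  have [s s_app hs] := fh n.+1 isT; have [_ le1 _] := contracts_numer s_app.
  rewrite /partial ler_pM2r ?invr_gt0 ?scaleR_gt0 // ler_nat.
  apply: leq_trans (le1 n) _; apply: leq_numer => k /andP[_ kn].
  by rewrite hs.
(* The contracted function agrees with [h] up to [n.+1], and its partial sum grows to one that the
   contractions did not change, hence to a partial sum of [f]. *)
have fh2 n : exists m, partial h n <= partial f m.
  have [s s_app hs] := fh n.+1 isT; have [_ _ [m eqm]] := contracts_numer s_app.
  exists (maxn n m); rewrite {2}/partial -eqm ?leq_maxr //.
  rewrite -/(partial _ _); apply: le_trans (partial_le _ (leq_maxl n m)).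
  rewrite /partial ler_pM2r ?invr_gt0 ?scaleR_gt0 // ler_nat.
  by apply: leq_numer => k /andP[_ kn]; rewrite hs.
by split; apply: value_cofinal => n //; exists n.
Qed.

Lemma value_bound f x : value f x ->
  exists K, forall n, (numer f n <= K * scale n)%N.
Proof.
move=> fx; have x0 := value_ge0 fx; exists (Num.truncn x).+1 => n.
have /andP[_ xlt] := Num.Theory.truncn_itv x0.
have := fx.1 n; rewrite /partial ler_pdivrMr ?scaleR_gt0 // => le1.
rewrite -(@ler_nat R) natrM; apply: le_trans le1 _.
by rewrite ler_pM2r ?scaleR_gt0 // ltW.
Qed.

Lemma value_normal_ex h : normal h -> exists x, value h x.
Proof.
move=> hh.
have sE : has_sup (range (partial h)).
  split; first by exists (partial h 0); exists 0%N.
  exists ((numer h 0).+1)%:R => _ [n _ <-].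
  rewrite /partial ler_pdivrMr ?scaleR_gt0 // -natrM ler_nat.
  by have := numer_normal_lt 0 n hh; rewrite add0n muln1; apply: ltnW.
exists (sup (range (partial h))); split=> [n|y ysup].
  by apply: sup_upper_bound => //; exists n.
have [_ [n _ <-] yn] := sup_gt sE.1 ysup; by exists n.
Qed.

(** The rounded-up prefix of [numer_normal_lt] bounds all later partial sums, hence their
    supremum. *)
Lemma value_normal_ub h x n : normal h -> value h x ->
  x * (scale n)%:R <= ((numer h n).+1)%:R.
Proof.
move=> hh [_ lb]; rewrite -ler_pdivlMr ?scaleR_gt0 // leNgt; apply/negP.
move=> /lb[m /lt_le_trans/(_ (partial_le h (leq_addl n m)))].
rewrite /partial ltr_pdivrMr ?scaleR_gt0 // mulrAC ltr_pdivlMr ?scaleR_gt0 //.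
rewrite -!natrM ltr_nat ltnNge => /negP; apply.
apply: leq_trans (numer_normal_lt n m hh); by rewrite leq_mul2r leqnSn orbT.
Qed.

Lemma value_lb h x n : value h x -> (numer h n)%:R <= x * (scale n)%:R.
Proof. by case=> /(_ n) + _; rewrite ler_pdivrMr ?scaleR_gt0. Qed.

Lemma inv_scale_small e : 0 < e -> exists n, (scale n)%:R^-1 < e :> R.
Proof.
move=> e0; have ie0 : 0 < e^-1 by rewrite invr_gt0.
have /andP[_ elt] := Num.Theory.truncn_itv (ltW ie0).
exists (Num.truncn e^-1); rewrite invf_plt ?posrE ?scaleR_gt0 //.
by apply: lt_le_trans elt _; rewrite ler_nat scale_gt.
Qed.

(** The partial sums differ by at most one unit of the last place, which tends to 0. This is applied
    to the pairs of [W1]. *)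
Lemma value_near f g x :
  (forall n, numer g n <= numer f n <= (numer g n).+1)%N ->
  value f x -> value g x.
Proof.
move=> fg [ub lb]; split=> [n|y yx].
  apply: le_trans (ub n); rewrite ler_pM2r ?invr_gt0 ?scaleR_gt0 // ler_nat.
  by case/andP: (fg n).
have e0 : 0 < (x - y) / 2 by lra.
have [n hn] := inv_scale_small e0.
have [m hm] : exists m, x - (x - y) / 2 < partial f m by apply: lb; lra.
exists (maxn n m).
set N := maxn n m.
have h1 : partial f N <= partial g N + (scale N)%:R^-1.
  rewrite /partial -[X in _ + X]mul1r -mulrDl natr1.
  by rewrite ler_pM2r ?invr_gt0 ?scaleR_gt0 // ler_nat; case/andP: (fg N).
have h2 : (scale N)%:R^-1 <= (scale n)%:R^-1 :> R.
  rewrite lef_pV2 ?posrE ?scaleR_gt0 // ler_nat (scale_span (leq_maxl n m)).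
  by rewrite leq_pmulr // span_gt0.
have := partial_le f (leq_maxr n m); rewrite -/N; lra.
Qed.

(** The prefix sums of [g] are the floors [p n] of [x] times [scale n], so its partial sums miss [x]
    by less than one unit of the last place. *)
Lemma value_surj x a : 0 <= x -> exists2 g, g 0%N = a & value g x.
Proof.
move=> x0; pose p n := Num.truncn (x * (scale n)%:R).
have xs0 n : 0 <= x * (scale n)%:R by rewrite mulr_ge0.
have pitv n := Num.Theory.truncn_itv (xs0 n).
pose g k := if k is k1.+1 then
  if k1 is k2.+1 then (p k1 - p k2 * theta k1)%N else p 0%N else a.
have gp n : numer g n = p n.
  (* The truncated subtraction in [g] is exact because [p n * theta n.+1 <= p n.+1]. *)
  elim: n => //= n ->; rewrite subnKC // -ltnS -(@ltr_nat R).
  have /andP[_] := pitv n.+1; apply: le_lt_trans.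
  by rewrite !natrM mulrA ler_wpM2r //; case/andP: (pitv n).
exists g => //; split=> [n|y yx].
  by rewrite /partial gp ler_pdivrMr ?scaleR_gt0 //; case/andP: (pitv n).
have [n hn] : exists n, (scale n)%:R^-1 < x - y by apply: inv_scale_small; lra.
exists n; rewrite /partial gp ltr_pdivlMr ?scaleR_gt0 //.
move: hn; rewrite -(ltr_pM2r (scaleR_gt0 n)) mulVf ?gt_eqF ?scaleR_gt0 //.
case/andP: (pitv n) => _; rewrite /p -natr1; lra.
Qed.

(** * The base set *)

Local Open Scope classical_set_scope.

Lemma posEq_sym f g : posEq f g -> posEq g f.
Proof. by move=> fg k k0; rewrite fg. Qed.

Lemma posEq_normal f g : posEq f g -> normal f -> normal g.
Proof. by move=> fg hf n; rewrite -fg. Qed.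

Lemma posEq_Ap f g : posEq f g -> A_p theta f -> A_p theta g.
Proof.
move=> fg [/normalP fn ft]; split.
  by apply/normalP; apply: posEq_normal fn.
by move=> N /ft[M NM hM]; exists M => //; rewrite -fg //; case: M NM {hM}.
Qed.

Lemma posEq_maximal f g N :
  posEq f g -> maximal_after theta f N -> maximal_after theta g N.
Proof.
by move=> fg [N0 hm]; split=> // M NM; rewrite -fg ?hm //; case: M NM.
Qed.

Lemma posEq_As f g : posEq f g -> A_s theta f -> A_s theta g.
Proof.
move=> fg [/normalP fn [N hN]]; split.
  by apply/normalP; apply: posEq_normal fn.
by exists N; apply: posEq_maximal hN.
Qed.

Lemma Ap_As_disjoint h : A_p theta h -> ~ A_s theta h.
Proof. by move=> [_ hp] [_ [N [/hp[M NM +] hs]]]; rewrite hs. Qed.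

Lemma normal_Ap_As h : normal h -> A_p theta h \/ A_s theta h.
Proof.
move=> /normalP hh; have [hs|hs] := pselect (exists N, maximal_after theta h N).
  by right.
left; split=> // N N0; apply: contrapT => hM; apply: hs; exists N; split=> // M NM.
by apply: contrapT => hM'; apply: hM; exists M.
Qed.

(** Similarity sees only the parity at 0, while [normal_value_eq] wants equal values there;
    resetting position 0 bridges the two. *)
Definition set_sign a h k := if k == 0%N then a else h k.

Lemma set_signP a h : posEq h (set_sign a h).
Proof. by case. Qed.

Lemma W1_set_sign a p : W1 theta p -> W1 theta (set_sign a p.1, set_sign a p.2).
Proof.
case=> hp hs [N [[Nmax Nmin] lt eqN gt]]; have N0 := Nmax.1.
split=> /=; [|by apply: posEq_As hs; apply: set_signP|exists N; split].
- by apply: posEq_Ap hp; apply: set_signP.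
- split; first by apply: posEq_maximal Nmax; apply: set_signP.
  by move=> N' hN'; apply: Nmin; apply: posEq_maximal hN'; apply/posEq_sym/set_signP.
- by case=> //= k kN; rewrite /set_sign /= lt.
- by case: (N) N0 eqN.
- by case=> // k Nk; rewrite /set_sign /= gt.
Qed.

(** Prefix sums agree before [N], the first component leads by one at [N], and afterwards the digits
    0 against [theta - 1] keep the lead at exactly one. *)
Lemma W1_numer p n : W1 theta p ->
  (numer p.2 n <= numer p.1 n <= (numer p.2 n).+1)%N.
Proof.
case=> _ _ [N [[[N0 Nmax] _] lt eqN gt]].
suff [h1 h2] : ((n.+1 < N)%N -> numer p.1 n = numer p.2 n) /\
               ((N <= n.+1)%N -> numer p.1 n = (numer p.2 n).+1).
  by case: (ltnP n.+1 N) => [/h1->|/h2->]; rewrite ?leqnn ?leqnSn.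
elim: n => [|n [IH1 IH2]] /=.
  split=> [|N1]; first exact: lt.
  by rewrite (_ : 1 = N)%N //; lia.
split=> [nN|]; first by rewrite lt // IH1 //; lia.
rewrite leq_eqVlt => /predU1P[NE|nN].
  by rewrite -NE eqN NE IH1 ?addnS // NE.
rewrite gt // IH2 // Nmax //=.
have := theta_ge2 (ltn0Sn n); lia.
Qed.

Lemma W1_normal p : W1 theta p -> normal p.1 /\ normal p.2.
Proof. by case=> [[/normalP ? _] [/normalP ? _] _]. Qed.

Lemma W1_value p x : W1 theta p -> value p.1 x -> value p.2 x.
Proof. by move=> hp; apply: value_near => n; apply: W1_numer. Qed.

Lemma W1_sign p : W1 theta p -> p.1 0%N = p.2 0%N.
Proof. by case=> _ _ [N [[[N0 _] _] lt _ _]]; apply: lt. Qed.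

(** Normality of [h'] prevents it from catching up after the first difference, and the upper bound
    caps the lead of [h] at one. A constant lead of one forces the digits 0 in [h] and [theta - 1]
    in [h']. *)
Lemma W1_adjacent h h' n : normal h -> normal h' -> h 0%N = h' 0%N ->
  (forall m, numer h m <= (numer h' m).+1)%N ->
  (forall m, (m < n)%N -> numer h m = numer h' m) ->
  (numer h' n < numer h n)%N -> W1 theta (h, h').
Proof.
move=> hh hh' e0 ub eqn ltn.
have step d : numer h (n + d) = (numer h' (n + d)).+1.
  apply/eqP; rewrite eqn_leq ub /= -(leq_pmul2r (scale_gt0 n)).
  apply: leq_trans (numer_mono h n d); apply: leq_trans (numer_normal_lt n d hh') _.
  by rewrite leq_mul2r ltn orbT.
have digits m : (n.+1 < m)%N -> h m = 0%N /\ h' m = (theta m.-1).-1.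
  case: m => [|[|m]] //; rewrite !ltnS => nm.
  have := step (m - n)%N; have := step (m - n).+1.
  rewrite addnS subnKC //=; have := hh' m; have := theta_ge2 (ltn0Sn m); nia.
have digitn : h n.+1 = (h' n.+1).+1.
  case: (n) eqn (step 0%N) => [|k] eqn; rewrite addn0 //= eqn // -addnS.
  by move/addnI.
have digitl k : (k < n.+1)%N -> h k = h' k.
  case: k => [|k] // kn; apply: (@numer_inj _ _ k) => [j jk|]; last by lia.
  by apply: eqn; lia.
have hmax : maximal_after theta h' n.+1.
  by split=> // M /digits[].
split=> /=.
- split; first by apply/normalP.
  move=> N N0; exists (maxn N n.+1).+1; first by rewrite ltnS leq_maxl.
  have nM : (n.+1 < (maxn N n.+1).+1)%N by rewrite ltnS leq_maxr.
  have [-> _] := digits _ nM.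
  have M0 : (0 < maxn N n.+1)%N by lia.
  by move/esym; have := theta_ge2 M0; rewrite /=; lia.
- by split; [apply/normalP|exists n.+1].
- exists n.+1; split=> //; last by move=> k /digits[].
  (* Were [h'] maximal already after a smaller [N], its digit at [n.+1] would be the largest
     possible and that of [h], one more, would not be normal. *)
  split=> // N [N0 hN]; rewrite leqNgt; apply/negP => Nn.
  have := hN _ Nn; case: n Nn digitn {eqn ltn step digits digitl hmax hN} => [|n].
    by lia.
  by move=> _ + h'n; rewrite h'n /=; have := hh n; have := theta_ge2 (ltn0Sn n); lia.
Qed.

(** The common value forces the prefix sums to differ by at most one, so at the first difference
    [W1_adjacent] applies with the larger function first. *)
Lemma normal_value_eq h h' x : normal h -> normal h' -> h 0%N = h' 0%N ->
  value h x -> value h' x -> [\/ h = h', W1 theta (h, h') | W1 theta (h', h)].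
Proof.
move=> hh hh' e0 hx hx'.
have ub g g' m : normal g' -> value g x -> value g' x ->
    (numer g m <= (numer g' m).+1)%N.
  move=> g'n gx g'x; rewrite -(@ler_nat R).
  exact: le_trans (value_lb m gx) (value_normal_ub m g'n g'x).
have [ex|nex] := pselect (exists m, numer h m != numer h' m); last first.
  constructor 1; apply/funext => -[//|k]; apply: (@numer_inj _ _ k); last by lia.
  by move=> m _; apply: contrapT => /eqP hm; apply: nex; exists m.
case: (ex_minnP ex) => n neq nmin.
have eqlt m : (m < n)%N -> numer h m = numer h' m.
  by move=> mn; apply/eqP; apply: contraLR mn => /nmin; rewrite leqNgt.
move: neq; rewrite neq_ltn => /orP[lt|lt].
  constructor 3; apply: (@W1_adjacent _ _ n) => // m; first exact: ub.
  by move/eqlt.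
constructor 2; apply: (@W1_adjacent _ _ n) => // m; exact: ub.
Qed.

(** For [0 <= x] these are the elements of the base set; [s = true] is the negative sign. *)
Definition stdset (s : bool) x : set (nat -> nat) :=
  [set h | [/\ normal h, odd (h 0%N) = s & value h x]].

Lemma sigmaP f g : sigma f = sigma g <-> odd (f 0%N) = odd (g 0%N).
Proof. by rewrite /sigma; do 2!case: odd. Qed.

Definition paired h := exists2 p, W1 theta p & component h p.

Lemma posEq_paired h h' : posEq h h' -> paired h -> paired h'.
Proof.
move=> hh' [p pW hp].
exists (set_sign (h' 0%N) p.1, set_sign (h' 0%N) p.2); first exact: W1_set_sign.
case: hp => hE; [left|right]; apply/funext => -[|k] //=;
  by rewrite -hh' // hE.
Qed.

(** All members of a class share sign and value. Conversely, up to the value at 0, a normal function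
    with these data equals the representative or is paired with it: a pairing stays inside a class
    of [F] and is impossible for one of [G2]. *)
Lemma B_is_stdset b : B theta b -> exists s x, 0 <= x /\ b = stdset s x.
Proof.
case=> [[p pW <-]|[h [hAp hnp] <-]].
  have [n1 n2] := W1_normal pW; have [x px] := value_normal_ex n1.
  exists (odd (p.1 0%N)), x; split; first exact: value_ge0 px.
  apply/seteqP; split=> h /=.
    case=> q [qW [eqpq /sigmaP ->] hq].
    have qx : value q.1 x by apply: eq_value px.
    have [qn1 qn2] := W1_normal qW.
    case: hq => ->; split=> //; last exact: W1_value qx.
    by rewrite -W1_sign.
  case=> hn hs hx; set a := h 0%N.
  have qW := W1_set_sign a pW.
  have sim : similar p.1 (set_sign a p.1).
    by split; [exact: set_signP|apply/sigmaP].
  have qx : value (set_sign a p.1) x by apply: eq_value px; apply: set_signP.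
  have qn : normal (set_sign a p.1) by apply: posEq_normal n1; apply: set_signP.
  case: (normal_value_eq hn qn _ hx qx) => // [hE|hW|hW].
  - by exists (set_sign a p.1, set_sign a p.2); split=> //; left.
  (* Here the modified [p.1] would be both primary and secondary. *)
  - by case: qW hW => [+ _ _] [_ +] _ => /Ap_As_disjoint.
  - by exists (set_sign a p.1, h); split=> //; right.
have hn : normal h by case: hAp => /normalP.
have [x hx] := value_normal_ex hn.
exists (odd (h 0%N)), x; split; first exact: value_ge0 hx.
apply/seteqP; split=> h' /=.
  case=> [[[/normalP h'n _] _] [hh' /sigmaP ->]].
  by split=> //; apply: eq_value hx.
case=> h'n h's h'x; set a := h' 0%N.
have gx : value (set_sign a h) x by apply: eq_value hx; apply: set_signP.
have gn : normal (set_sign a h) by apply: posEq_normal hn; apply: set_signP.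
have gnp : ~ paired (set_sign a h).
  by move=> /(posEq_paired (posEq_sym (set_signP a h))).
case: (normal_value_eq h'n gn _ h'x gx) => // [h'E|h'W|h'W].
- have hh' : posEq h h' by rewrite h'E; apply: set_signP.
  split; last by split=> //; apply/sigmaP.
  by split; [exact: posEq_Ap hAp|rewrite h'E].
- by case: gnp; exists (h', set_sign a h) => //; right.
- by case: gnp; exists (set_sign a h, h') => //; left.
Qed.

(* The partner of a secondary function [h] adds one at its position N_min and
   erases everything after it. *)
Lemma As_paired h : A_s theta h -> paired h.
Proof.
move=> [/normalP hn [N0 hN0]].
have ex : exists N, `[< maximal_after theta h N >] by exists N0; apply/asboolP.
case: (ex_minnP ex) => N /asboolP hN Nmin.
have NP := hN.1.
pose g k := if (k < N)%N then h k else if k == N then (h N).+1 else 0%N.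
have gN : g N = (h N).+1 by rewrite /g ltnn eqxx.
have gt k : (N < k)%N -> g k = 0%N by move=> Nk; rewrite /g ltnNge (ltnW Nk) gtn_eqF.
exists (g, h); last by right.
split=> /=.
- split; last first.
    move=> M M0; exists (maxn N M).+1; first by rewrite ltnS leq_maxr.
    rewrite gt ?ltnS ?leq_maxl //= => /esym.
    have NM : (0 < maxn N M)%N by lia.
    by have := theta_ge2 NM; lia.
  apply/normalP => n; have th := theta_ge2 (ltn0Sn n).
  case: (ltngtP n.+2 N) => [nN|Nn|nN].
  + by rewrite /g nN; apply: hn.
  + by rewrite gt //; lia.
  (* If the digit at [N] were already maximal, [h] would be maximal after [N - 1], against the
     minimality of [N]. *)
  rewrite nN gN -nN; have := hn n; rewrite leq_eqVlt => /predU1P[hE|//].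
  have : maximal_after theta h n.+1.
    split=> // M; rewrite leq_eqVlt => /predU1P[<-|nM]; first by rewrite -hE.
    by apply: hN.2; rewrite -nN.
  by move/asboolP/Nmin; rewrite -nN ltnn.
- by split; [apply/normalP|exists N].
- exists N; split=> //; last by move=> k kN; rewrite /g kN.
  by split=> // N' hN'; apply: Nmin; apply/asboolP.
Qed.

Lemma normal_in_B h : normal h -> exists2 b, B theta b & b h.
Proof.
move=> hn; have [[p pW hp]|hp] := pselect (paired h).
  exists [set h | exists q, [/\ W1 theta q, similar p.1 q.1 & component h q]].
    by left; exists p.
  by exists p; split.
have hA : A_p theta h by case: (normal_Ap_As hn) => // /As_paired.
exists [set h' | W2 theta h' /\ similar h h']; last by split=> //; split.
by right; exists h.
Qed.

(** * Real numbers as classes of functions with a given sign and value *)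

Lemma reduces_sign f h : reduces f h -> h 0%N = f 0%N.
Proof.
by move=> /(_ 1%N isT)[s s_app <-] //; case: (contracts_numer s_app).
Qed.

Lemma value_reduces_ex f x : value f x ->
  exists h, [/\ normal h, reduces f h, h 0%N = f 0%N & value h x].
Proof.
move=> fx; have [K bnd] := value_bound fx.
have [h hn fh] := reduces_ex bnd; exists h; split=> //.
  exact: reduces_sign.
by apply/(value_reduces _ fh).
Qed.

Lemma stdset_nonempty s x : 0 <= x -> exists h, stdset s x h.
Proof.
move=> x0; have [g g0 gx] := value_surj s x0.
have [h [hn _ h0 hx]] := value_reduces_ex gx.
by exists h; split=> //; rewrite h0 g0; case: s {g0}.
Qed.

Lemma B_stdset s x : 0 <= x -> B theta (stdset s x).
Proof.
move=> /(stdset_nonempty s)[h [hn hs hx]].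
have [b bB bh] := normal_in_B hn.
have [s' [x' [_ bE]]] := B_is_stdset bB; move: (bh); rewrite bE.
by case=> _ s'E /(value_uniq hx) xx'; rewrite -hs xx' s'E -bE.
Qed.

Lemma stdset_inj s s' x x' : 0 <= x -> stdset s x = stdset s' x' ->
  s = s' /\ x = x'.
Proof.
move=> /(stdset_nonempty s)[h hx] E; move: (hx); rewrite E.
case: hx => _ <- hx [_ <- hx']; split=> //; exact: value_uniq hx hx'.
Qed.

(** Reduction preserves the sign and the value, and every function of finite value reduces to some
    normal form. *)
Lemma r_stdset s x : r theta (stdset s x) =
  [set f | odd (f 0%N) = s /\ value f x].
Proof.
apply/seteqP; split=> f /=.
  case=> h [hn hs hx] fh; split; first by rewrite -(reduces_sign fh).
  by apply/(value_reduces _ fh).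
case=> fs fx; have [h [hn fh h0 hx]] := value_reduces_ex fx.
by exists h => //; split=> //; rewrite h0.
Qed.

Lemma block_unique (P : set (set (nat -> nat))) f X :
  P X -> X f -> (forall Y, P Y -> Y f -> Y = X) -> block P f = X.
Proof.
move=> PX Xf uniq; rewrite /block; case: xgetP => [Y _ [PY Yf]|/(_ X)[]//].
exact: uniq.
Qed.

Lemma block_B_stdset h s x : stdset s x h -> block (B theta) h = stdset s x.
Proof.
move=> hsx; apply: block_unique => // [|b bB bh].
  by apply: B_stdset; case: hsx => _ _ /value_ge0.
have [s' [x' [_ bE]]] := B_is_stdset bB; move: bh; rewrite bE => -[_ <- hx'].
by case: hsx => _ <- /(value_uniq hx') <-.
Qed.

Lemma value_zero h : (forall k, (0 < k)%N -> h k = 0%N) -> value h 0.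
Proof.
(* On the positive positions [g = h + g], so [h] has the value of [g] minus itself. *)
move=> h0; have [g _ gx] := value_surj 0 (lexx 0).
suff -> : 0 = 0 - 0 :> R by apply: (valueB _ gx gx) => k k0; rewrite h0.
by rewrite subr0.
Qed.

Lemma normal_zero h : (forall k, (0 < k)%N -> h k = 0%N) -> normal h.
Proof. by move=> h0 n; rewrite h0 // ltnW // theta_ge2. Qed.

Lemma b1E : b1 theta = stdset false 0.
Proof.
by apply: block_B_stdset; split=> //; [apply: normal_zero|apply: value_zero].
Qed.

Lemma b2E : b2 theta = stdset true 0.
Proof.
by apply: block_B_stdset; split=> //; [apply: normal_zero|apply: value_zero];
  case.
Qed.

Lemma zeroRE : zeroR theta = [set f | value f 0].
Proof.
rewrite /zeroR b1E b2E !r_stdset; apply/seteqP; split=> f /=; first by case=> -[].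
by move=> f0; case E: (odd (f 0%N)); [right|left].
Qed.

(* Negative reals are the functions that are odd at 0; at [a = 0] both signs are
   allowed. *)
Definition realOf (a : R) : set (nat -> nat) :=
  [set f | value f `|a| /\ (a != 0 -> odd (f 0%N) = (a < 0))].

Lemma realOf0 : realOf 0 = zeroR theta.
Proof.
rewrite zeroRE /realOf normr0; apply/seteqP; split=> f /=; first by case.
by split=> //; rewrite eqxx.
Qed.

Lemma realOf_r a : a != 0 -> realOf a = r theta (stdset (a < 0) `|a|).
Proof.
move=> a0; rewrite r_stdset; apply/seteqP; split=> f /=.
  by case=> fa /(_ a0).
by case.
Qed.

Lemma S_RP X : S_R theta X <-> exists a, X = realOf a.
Proof.
split=> [[[b [bB bn] <-]|->]|[a ->]]; last 2 first.
- by exists 0; rewrite realOf0.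
- have [->|a0] := eqVneq a 0; first by right; rewrite realOf0.
  left; exists (stdset (a < 0) `|a|); last by rewrite realOf_r.
  split; first exact: B_stdset.
  by rewrite b1E b2E => -[] /stdset_inj -[]// _ /eqP; rewrite normr_eq0 (negPf a0).
have [s [x [x0 bE]]] := B_is_stdset bB.
have xn0 : x != 0.
  apply/eqP => xE; apply: bn; rewrite b1E b2E bE xE.
  by case: (s); [right|left].
exists (if s then - x else x); rewrite realOf_r; last first.
  by case: (s); rewrite ?oppr_eq0.
rewrite bE; congr (r _ (stdset _ _)); case: (s) => /=.
- by rewrite oppr_lt0 lt_def xn0.
- by rewrite ltNge x0.
- by rewrite normrN ger0_norm.
- by rewrite ger0_norm.
Qed.

Lemma realOf_uniq f a a' : realOf a f -> realOf a' f -> a = a'.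
Proof.
move=> [fa sa] [fa' sa']; have := value_uniq fa fa'.
have [->|a0] := eqVneq a 0.
  by rewrite normr0 => /esym/eqP; rewrite normr_eq0 => /eqP.
have [->|a'0] := eqVneq a' 0.
  by rewrite normr0 => /eqP; rewrite normr_eq0 => /eqP.
move: (sa a0) (sa' a'0) => ->.
have [h1|h1] := ltrP a 0; have [h2|h2] := ltrP a' 0 => //= _.
- by rewrite !ltr0_norm // => /oppr_inj.
- by rewrite !ger0_norm.
Qed.

Lemma classE f a : realOf a f -> class theta f = realOf a.
Proof.
move=> fa; apply: block_unique => // [|Y]; first by apply/S_RP; exists a.
by move=> /S_RP[a' ->] /(realOf_uniq fa) ->.
Qed.

(** * Order and addition *)

Lemma realOf_nonempty a : exists f, realOf a f.
Proof.
have [f f0 fa] := value_surj (a < 0)%R (normr_ge0 a).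
by exists f; split=> // _; rewrite f0; case: ltP.
Qed.

Lemma realOf_inj : injective realOf.
Proof.
move=> a a' aa'; have [f fa] := realOf_nonempty a.
by apply: (realOf_uniq fa); rewrite -aa'.
Qed.

Lemma repr_realOf a : realOf a (Defs.repr (realOf a)).
Proof. by apply: xgetPex; apply: realOf_nonempty. Qed.

Lemma absR_realOf a : absR theta (realOf a) = realOf `|a|.
Proof.
apply: classE; have [fa _] := repr_realOf a; split.
  by rewrite normr_id; apply: eq_value fa; case.
by rewrite ltNge normr_ge0.
Qed.

Lemma sigmaR_realOf x : 0 < x -> sigmaR (realOf x) = 1%N.
Proof.
move=> x0; have [_] := repr_realOf x; rewrite gt_eqF // => /(_ isT).
by rewrite /sigmaR /sigma => ->; rewrite ltNge ltW.
Qed.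

Lemma realOf_eq_zeroR x : realOf x = zeroR theta -> x = 0.
Proof. by rewrite -realOf0 => /realOf_inj. Qed.

(** Nonnegative values suffice, since [subsum] compares absolute values only. *)
Lemma leR_realOf x y : 0 <= x -> 0 <= y ->
  leR theta (realOf x) (realOf y) <-> x <= y.
Proof.
rewrite le_eqVlt => /predU1P[<-|x0].
  move=> y0; split=> // _; rewrite realOf0; move: y0.
  rewrite le_eqVlt => /predU1P[<-|y0].
    by rewrite realOf0; constructor 4.
  constructor 3; split=> //; last exact: sigmaR_realOf.
  by move/realOf_eq_zeroR => yE; rewrite yE ltxx in y0.
have xn : realOf x <> zeroR theta.
  by move/realOf_eq_zeroR => xE; rewrite xE ltxx in x0.
have sx := sigmaR_realOf x0.
rewrite le_eqVlt => /predU1P[<-|y0].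
  rewrite realOf0 leNgt x0; split=> //.
  by case=> [[]|[_ _]|[]|[]] //; rewrite sx.
have yn : realOf y <> zeroR theta.
  by move/realOf_eq_zeroR => yE; rewrite yE ltxx in y0.
have sy := sigmaR_realOf y0.
split=> [[[_ _]|[]|[]|[]] //|xy].
  case=> [|[_ _ le]|[]]; rewrite ?sx ?sy //.
  have [f fx] := realOf_nonempty x; have [g gy fg] := le _ fx.
  have := value_le fg fx.1 gy.1; by rewrite !ger0_norm // ltW.
constructor 1; split=> //; constructor 2; split=> // f [fx fs].
(* Adding a function of value [y - x] to [f] gives a dominating element of the class of [y]. *)
have [d _ dx] : exists2 d, d 0%N = 0%N & value d (y - x).
  by apply: value_surj; rewrite subr_ge0.
exists (fun k => if k is 0 then f 0 else f k + d k)%N; last first.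
  by case=> // n _; apply: leq_addr.
split=> /= [|_]; last by rewrite fs ?gt_eqF // !ltNge !ltW.
rewrite ger0_norm ?ltW // (_ : y = x + (y - x)); last by lra.
by rewrite gtr0_norm // in fx; apply: (valueD _ fx dx); case.
Qed.

(** Ensures that [primary] returns an element of the class and not its default. *)
Lemma realOf_Ap a : exists h, realOf a h /\ A_p theta h.
Proof.
suff [h [hn hs hx] hA] : exists2 h, stdset (a < 0) `|a| h & A_p theta h.
  by exists h; split.
case: (B_stdset (a < 0) (normr_ge0 a)) => [[p pW E]|[h [hA hnp] E]].
  exists p.1; last by case: pW.
  by rewrite -E; exists p; split=> //; left.
by exists h => //; rewrite -E; split.
Qed.

Lemma primary_realOf a : realOf a (primary theta (realOf a)).
Proof.
have : (realOf a `&` A_p theta) (primary theta (realOf a)).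
  by apply: xgetPex; have [h [? ?]] := realOf_Ap a; exists h.
by case.
Qed.

(** * Tracking functions *)

Section Tracking.
Variables (f g : nat -> nat) (a b : R).
Hypotheses (fa : realOf a f) (gb : realOf b g) (ba : `|b| < `|a|).
Hypothesis opp : b != 0 -> (b < 0) = ~~ (a < 0).

Lemma tracking_arith : [/\ a != 0, `|a + b| = `|a| - `|b| & (a + b < 0) = (a < 0)].
Proof.
have a0 : a != 0 by rewrite -normr_gt0 (le_lt_trans _ ba).
split=> //; have [->|b0] := eqVneq b 0; rewrite ?addr0 ?normr0 ?subr0 //.
  move: ba (opp b0); have [h1|h1] := ltrP a 0; have [h2|h2] := ltrP b 0 => //=.
    rewrite (ltr0_norm h1) (ger0_norm h2) => ba' _; rewrite ltr0_norm; lra.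
  rewrite (ger0_norm h1) (ltr0_norm h2) => ba' _; rewrite ger0_norm; lra.
move: ba (opp b0); have [h1|h1] := ltrP a 0; have [h2|h2] := ltrP b 0 => //=.
  by rewrite (ltr0_norm h1) (ger0_norm h2) => ba' _; apply/idP; lra.
rewrite (ger0_norm h1) (ltr0_norm h2) => ba' _; apply/negbTE.
by rewrite -leNgt; lra.
Qed.

Lemma tracking_sub : tracking theta f g `<=` realOf (a + b).
Proof.
have [a0 absE sE] := tracking_arith.
move=> rho [w []]; rewrite (classE fa) => -[wa ws] gw r0 rE; split.
  by rewrite absE; apply: valueB wa gb.1 => k k0; rewrite rE // subnK // gw.
by move=> _; rewrite r0 ws.
Qed.

(** The element of the class of [a] is built upwards from [g], by adding a function [d] of the
    missing value, so that it dominates [g]. *)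
Lemma tracking_nonempty : tracking theta f g !=set0.
Proof.
have [d _ dx] : exists2 d, d 0%N = 0%N & value d (`|a| - `|b|).
  by apply: value_surj; rewrite subr_ge0 ltW.
pose w k := if k is 0 then f 0%N else (g k + d k)%N.
exists (fun k => if k is 0 then w 0%N else w k - g k)%N, w.
split=> //; last 2 first.
- by case=> // n _; apply: leq_addr.
- by case.
rewrite (classE fa); split; last exact: fa.2.
rewrite (_ : `|a| = `|b| + (`|a| - `|b|)); last by lra.
by apply: (valueD _ gb.1 dx); case.
Qed.

(** Since some tracking function exists, only one real number can contain them all. *)
Lemma tracking_classE : tracking_class theta f g = realOf (a + b).
Proof.
rewrite /tracking_class; case: xgetP => [X _ [/S_RP[c ->] sub]|/(_ (realOf (a + b)))].
  have [rho rT] := tracking_nonempty; congr realOf.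
  exact: realOf_uniq (sub _ rT) (tracking_sub rT).
by case; split; [apply/S_RP; exists (a + b)|exact: tracking_sub].
Qed.

Lemma primary_trackingP : realOf (a + b) (primary_tracking theta f g).
Proof.
have [a0 absE sE] := tracking_arith; split.
  have [pv _] := primary_realOf (a + b); rewrite /primary_tracking tracking_classE.
  by apply: eq_value pv; case.
by move=> _; rewrite sE -fa.2.
Qed.

End Tracking.

(** Each branch of [subsum] realises the signed sum: equal signs add up, while opposite signs or a
    zero summand cancel or lead to tracking. *)
Lemma addR_realOf a b : addR theta (realOf a) (realOf b) = realOf (a + b).
Proof.
apply: classE; set f := Defs.repr _; set g := Defs.repr _.
have fa : realOf a f := repr_realOf a; have gb : realOf b g := repr_realOf b.
have zP c h : realOf c h -> (zeroR theta h <-> c = 0).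
  by rewrite -realOf0 => hc; split=> [h0|<-//]; apply: realOf_uniq hc h0.
rewrite /subsum !(classE fa, classE gb) !absR_realOf.
case: asboolP => [[/sigmaP s /(zP _ _ fa)/eqP a0 /(zP _ _ gb)/eqP b0]|same].
  move: (s); rewrite fa.2 // gb.2 // => sab.
  have nab : `|a + b| = `|a| + `|b| /\ (a + b < 0) = (a < 0).
    move: sab a0 b0; have [h1|h1] := ltrP a 0; have [h2|h2] := ltrP b 0 => //= _ a0 b0.
      rewrite (ltr0_norm h1) (ltr0_norm h2); split; last by apply/idP; lra.
      by rewrite ltr0_norm; lra.
    rewrite (ger0_norm h1) (ger0_norm h2); split; first by rewrite ger0_norm; lra.
    by apply/negbTE; rewrite -leNgt; lra.
  split.
    by rewrite nab.1; apply: valueD fa.1 gb.1; case.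
  (* A product of two numbers of equal parity keeps that parity, hence the common sign. *)
  by move=> _ /=; rewrite oddM -s andbb fa.2 // nab.2.
have opp : a != 0 -> b != 0 -> (b < 0) = ~~ (a < 0).
  move=> a0 b0; rewrite -(fa.2 a0) -(gb.2 b0).
  have : odd (f 0%N) <> odd (g 0%N).
    move=> s; apply: same; split; first by apply/sigmaP.
      by move/(zP _ _ fa)/eqP; rewrite (negPf a0).
    by move/(zP _ _ gb)/eqP; rewrite (negPf b0).
  by do 2!case: odd.
case: asboolP => [/realOf_inj nab|nab].
  suff -> : a + b = 0 by rewrite realOf0 zeroRE; apply: value_zero.
  have [a0|a0] := eqVneq a 0.
    by move/esym/eqP: nab; rewrite a0 normr0 normr_eq0 => /eqP->; rewrite addr0.
  have b0 : b != 0 by rewrite -normr_eq0 -nab normr_eq0.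
  move: nab (opp a0 b0).
  have [h1|h1] := ltrP a 0; have [h2|h2] := ltrP b 0 => //=.
    by rewrite (ltr0_norm h1) (ger0_norm h2) => <-; rewrite addrN.
  by rewrite (ger0_norm h1) (ltr0_norm h2) => -> _; rewrite addNr.
have nz x y : `|x| < `|y| :> R -> y != 0.
  by move=> xy; rewrite -normr_gt0 (le_lt_trans _ xy).
have ltR_abs x y : ltR theta (realOf `|x|) (realOf `|y|) <-> `|x| < `|y| :> R.
  have le := leR_realOf (normr_ge0 y) (normr_ge0 x).
  by rewrite /ltR ltNge; split=> [h|/negP h]; [apply/negP|]; move/le/h.
case: asboolP => [/ltR_abs ba|nba].
  by apply: primary_trackingP => //; apply: opp; apply: nz ba.
have ab : `|a| < `|b|.
  rewrite lt_neqAle leNgt; apply/andP; split.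
    by apply/eqP => E; apply: nab; rewrite E.
  by apply/negP => /ltR_abs.
(* In this branch [f] is subtracted from [g], so the summands exchange roles. *)
rewrite addrC; apply: primary_trackingP => // a0.
by rewrite opp ?negbK //; apply: nz ab.
Qed.

End NumberSystem.

Theorem mainTheorem9 (theta : nat -> nat)
    (htheta : forall n : nat, 0 < n -> 2 <= theta n)
    (f g w : set (nat -> nat))
    (hf : S_R theta f) (hg : S_R theta g) (hw : S_R theta w) :
  addR theta (addR theta f g) w = addR theta f (addR theta g w).
Proof.
(* The statement mentions no field of values; the abstract [R] is instantiated by the concrete
   reals. *)
have toR X : S_R theta X -> exists a : Rdefinitions.R, X = realOf theta a.
  by move=> /(S_RP htheta).
have [[a ->] [b ->] [c ->]] := And3 (toR f hf) (toR g hg) (toR w hw).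
by rewrite !addR_realOf // addrA.
Qed.
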